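(* For all integers $M\ge1$ and $i\ge1$, the number of NPRK$_M$ order conditions of order $i$ is $1/M$ times the number of ARK$_M$ order conditions of order $i$, i.e. $$\sigma^{[M]}_i=\alpha^{[M]}_i .$$
   Context: The number $\sigma^{[M]}_i$ of NPRK$_M$ (nonlinearly partitioned Runge--Kutta with $M$ partitions) order conditions of order $i$ is the number of (equivalence classes of) $M$-edge-colored rooted trees with $i$ nodes: finite rooted trees each of whose edges carries a color in $\{1,\dots,M\}$, up to isomorphism preserving the root and the edge colors. The number of ARK$_M$ ($M$-component additive Runge--Kutta) order conditions of order $i$ is the number of (equivalence classes of) $M$-node-colored rooted trees with $i$ nodes: finite rooted trees each of whose nodes (including the root) carries a color in $\{1,\dots,M\}$, up to isomorphism preserving the root and the node colors. This number is denoted $M\alpha^{[M]}_i$, where $\alpha^{[M]}_i$ is determined by the formal power series identity $$\sum_{i=1}^\infty\alpha^{[M]}_ix^{i-1}=\prod_{i=1}^\infty(1-x^i)^{-M\alpha^{[M]}_i}.$$ *)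

(* Defs.v *)
From HB Require Import structures.
From mathcomp Require Import all_boot all_order all_fingroup all_algebra.

Set Implicit Arguments.
Unset Strict Implicit.
Unset Printing Implicit Defensive.

Import Order.TTheory GRing.Theory Num.Theory.

(* [ucycleb e s] says that [s] is a closed [e]-walk without repeated vertices;
   in a simple graph it is a genuine cycle as soon as it has at least three
   vertices (an edge x -- y gives the degenerate closed walk [:: x; y]).  A
   sequence without repetition has at most #|T| items, so that bounding the
   length of [s] loses nothing. *)
Definition acyclic (T : finType) (e : rel T) : bool :=
  [forall k : 'I_#|T|.+1, forall s : k.-tuple T, (2 < k) ==> ~~ ucycleb e s].

Definition is_tree (T : finType) (e : rel T) : bool :=
  [&& [forall x, ~~ e x x],
      [forall x, forall y, e x y == e y x],
      [forall x, forall y, connect e x y]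
    & acyclic e].

(* A root and an edge-colored graph on the vertex set [T]: the value at (x, y)
   is [Some c] if {x, y} is an edge with color c, and [None] if it is not an
   edge. *)
Definition ecgraph (M : nat) (T : finType) : Type :=
  (T * {ffun T -> {ffun T -> option 'I_M}})%type.

HB.instance Definition _ M T := Finite.on (ecgraph M T).

Section EdgeColored.
Variables (M : nat) (T : finType).
Implicit Types t u : ecgraph M T.

Definition ec_root t : T := t.1.
Definition ec_color t (x y : T) : option 'I_M := t.2 x y.
Definition ec_adj t : rel T := [rel x y | isSome (ec_color t x y)].

Definition is_ectree t : bool :=
  is_tree (ec_adj t) && [forall x, forall y, ec_color t x y == ec_color t y x].

Definition ec_iso : rel (ecgraph M T) := fun t u =>
  [exists s : {perm T},
     (s (ec_root t) == ec_root u) &&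
     [forall x, forall y, ec_color u (s x) (s y) == ec_color t x y]].

Lemma ec_iso_equiv : equivalence_rel ec_iso.
Proof.
apply/equivalence_relP; split=> [t|t u].
  apply/existsP; exists 1%g; rewrite perm1 eqxx.
  by apply/forallP=> x; apply/forallP=> y; rewrite !perm1.
move=> /existsP[s /andP[/eqP hr /forallP hs]].
have hsE x y : ec_color u (s x) (s y) = ec_color t x y.
  by apply/eqP; have /forallP := hs x; apply.
move=> v; apply/existsP/existsP => -[s' /andP[/eqP hr' /forallP hs']].
  exists (s^-1 * s')%g; rewrite permM -hr permK hr' eqxx.
  apply/forallP=> x; apply/forallP=> y; rewrite !permM.
  have /forallP/(_ (s^-1 y)%g)/eqP -> := hs' (s^-1 x)%g.
  by rewrite -hsE !permKV.
exists (s * s')%g; rewrite permM hr hr' eqxx.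
apply/forallP=> x; apply/forallP=> y; rewrite !permM.
by have /forallP/(_ (s y))/eqP -> := hs' (s x); rewrite hsE.
Qed.

End EdgeColored.

(* sigma^[M]_i *)
Definition nprk_conditions (M i : nat) : nat :=
  #|equivalence_partition (@ec_iso M 'I_i) [set t | is_ectree t]|.

(* A root, the adjacency matrix, and the colors of the vertices. *)
Definition ncgraph (M : nat) (T : finType) : Type :=
  (T * {ffun T -> {ffun T -> bool}} * {ffun T -> 'I_M})%type.

HB.instance Definition _ M T := Finite.on (ncgraph M T).

Section NodeColored.
Variables (M : nat) (T : finType).
Implicit Types t u : ncgraph M T.

Definition nc_root t : T := t.1.1.
Definition nc_adj t : rel T := fun x y => t.1.2 x y.
Definition nc_color t (x : T) : 'I_M := t.2 x.

Definition is_nctree t : bool := is_tree (nc_adj t).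

Definition nc_iso : rel (ncgraph M T) := fun t u =>
  [exists s : {perm T},
     [&& s (nc_root t) == nc_root u,
         [forall x, forall y, nc_adj u (s x) (s y) == nc_adj t x y]
       & [forall x, nc_color u (s x) == nc_color t x]]].

Lemma nc_iso_equiv : equivalence_rel nc_iso.
Proof.
apply/equivalence_relP; split=> [t|t u].
  apply/existsP; exists 1%g; rewrite perm1 eqxx /=.
  apply/andP; split; apply/forallP=> x; rewrite ?perm1 //.
  by apply/forallP=> y; rewrite !perm1.
move=> /existsP[s /and3P[/eqP hr /forallP hs /forallP hc]].
have hsE x y : nc_adj u (s x) (s y) = nc_adj t x y.
  by apply/eqP; have /forallP := hs x; apply.
have hcE x : nc_color u (s x) = nc_color t x by apply/eqP.
move=> v; apply/existsP/existsP => -[s' /and3P[/eqP hr' /forallP hs' /forallP hc']].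
  exists (s^-1 * s')%g; rewrite permM -hr permK hr' eqxx /=.
  apply/andP; split; apply/forallP=> x; last first.
    by rewrite permM (eqP (hc' _)) -hcE permKV.
  apply/forallP=> y; rewrite !permM.
  have /forallP/(_ (s^-1 y)%g)/eqP -> := hs' (s^-1 x)%g.
  by rewrite -hsE !permKV.
exists (s * s')%g; rewrite permM hr hr' eqxx /=.
apply/andP; split; apply/forallP=> x; last by rewrite permM (eqP (hc' _)) hcE.
apply/forallP=> y; rewrite !permM.
by have /forallP/(_ (s y))/eqP -> := hs' (s x); rewrite hsE.
Qed.

End NodeColored.

(* M alpha^[M]_i *)
Definition ark_conditions (M i : nat) : nat :=
  #|equivalence_partition (@nc_iso M 'I_i) [set t | is_nctree t]|.

Local Open Scope ring_scope.

(* [f n] is the coefficient of x^n. *)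
Definition fps (R : Type) : Type := nat -> R.

Section FPS.
Variable R : comUnitRingType.
Implicit Types f g h : fps R.

Definition fps_one : fps R := fun n => (n == 0%N)%:R.

Definition fps_mul f g : fps R :=
  fun n => \sum_(j < n.+1) f j * g (n - j)%N.

Definition fps_exp f (k : nat) : fps R := iter k (fps_mul f) fps_one.

(* The coefficients 0, ..., n of the inverse of [f], for [f 0] a unit, by the
   usual recursion g_n = - g_0 \sum_(j < n) g_j f_(n-j). *)
Fixpoint fps_inv_seq f (n : nat) : seq R :=
  if n is n'.+1 then
    let s := fps_inv_seq f n' in
    rcons s (- ((f 0%N)^-1 * \sum_(j < n) s`_j * f (n - j)%N))
  else [:: (f 0%N)^-1].

Definition fps_inv f : fps R := fun n => (fps_inv_seq f n)`_n.

Definition fps_1subX (i : nat) : fps R := fun n => (n == 0%N)%:R - (n == i)%:R.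

(* [P] is the infinite product F 1 * F 2 * ..., in the topology of
   coefficientwise stabilization. *)
Definition is_fps_infprod (F : nat -> fps R) (P : fps R) : Prop :=
  forall n : nat, exists N : nat, forall m : nat, (N <= m)%N ->
    (\big[fps_mul/fps_one]_(1 <= i < m.+1) F i) n = P n.

End FPS.

(* \sum_(i >= 1) alpha_i x^(i-1) = \prod_(i >= 1) (1 - x^i)^(- M alpha_i).
   The value [alpha 0] is irrelevant. *)
Definition ark_series_identity (M : nat) (alpha : nat -> nat) : Prop :=
  is_fps_infprod
    (fun i => fps_exp (fps_inv (fps_1subX int i)) (M * alpha i))
    (fun n => (alpha n.+1)%:Z).

Section FPSTheory.
Variable R : comUnitRingType.
Implicit Types f g h : fps R.

Lemma size_fps_inv_seq f n : size (fps_inv_seq f n) = n.+1.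
Proof. by elim: n => //= n IH; rewrite size_rcons IH. Qed.

Lemma nth_fps_inv_seq f n j : (j <= n)%N -> (fps_inv_seq f n)`_j = fps_inv f j.
Proof.
elim: n => [|n IH]; first by rewrite leqn0 => /eqP->.
rewrite leq_eqVlt => /predU1P[->//|]; rewrite ltnS => jn.
by rewrite /= nth_rcons size_fps_inv_seq ltnS jn IH.
Qed.

Lemma fps_invS f n : fps_inv f n.+1 =
  - ((f 0%N)^-1 * \sum_(j < n.+1) fps_inv f j * f (n.+1 - j)%N).
Proof.
rewrite {1}/fps_inv /= nth_rcons size_fps_inv_seq ltnn eqxx.
congr (- (_ * _)); apply: eq_bigr => j _.
by rewrite nth_fps_inv_seq // -ltnS.
Qed.

Lemma fps_mulVf f : f 0%N \is a GRing.unit ->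
  fps_mul (fps_inv f) f =1 fps_one R.
Proof.
move=> Uf [|n]; rewrite /fps_mul /fps_one.
  by rewrite big_ord_recr big_ord0 /= add0r subnn mulVr.
rewrite big_ord_recr /= subnn fps_invS mulNr mulrAC mulVr // mul1r.
exact: subrr.
Qed.

End FPSTheory.

Lemma fps_inv_1subX (i n : nat) : (0 < i)%N ->
  fps_inv (fps_1subX int i) n = (i %| n)%:R.
Proof.
move=> i0; have f0 : fps_1subX int i 0 = 1.
  by rewrite /fps_1subX eqxx eq_sym -leqn0 leqNgt i0 subr0.
elim/ltn_ind: n => -[|n] IH; first by rewrite /fps_inv /= f0 dvdn0.
rewrite fps_invS f0 invr1 mul1r.
have [ni|ni] := ltnP n.+1 i.
  rewrite gtnNdvd // big1 ?oppr0 // => j _.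
  rewrite /fps_1subX subn_eq0 leqNgt ltn_ord /=.
  by rewrite ltn_eqF ?subr0 ?mulr0 // (leq_ltn_trans (leq_subr _ _)).
have jP : (n.+1 - i < n.+1)%N by rewrite ltn_subrL i0.
rewrite (bigD1 (Ordinal jP)) //= big1 ?addr0 => [|j /negPf jN].
  rewrite IH // /fps_1subX subKn // eqxx -leqn0 leqNgt i0 /= sub0r mulrN1 opprK.
  by rewrite -{2}(subnK ni) dvdn_addl.
rewrite /fps_1subX subn_eq0 leqNgt ltn_ord /=.
suff -> : (n.+1 - j == i)%N = false by rewrite subr0 mulr0.
apply: contraFF jN => /eqP E; apply/eqP/val_inj => /=.
by rewrite -E subKn // ltnW.
Qed.

Section Determined.
Variable M : nat.
Implicit Types a b : nat -> nat.

Let factor a i : fps int := fps_exp (fps_inv (fps_1subX int i)) (M * a i).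
Let partial a m : fps int := \big[@fps_mul int/fps_one int]_(1 <= i < m.+1) factor a i.

Let geom_ge0 i n : (0 < i)%N -> 0 <= fps_inv (fps_1subX int i) n.
Proof. by move=> i0; rewrite fps_inv_1subX. Qed.

Let factor_ge0 a i n : (0 < i)%N -> 0 <= factor a i n.
Proof.
move=> i0; rewrite /factor; elim: (M * a i)%N n => [|k IH] n /=.
  by rewrite /fps_one ler0n.
by apply: sumr_ge0 => j _; rewrite mulr_ge0 ?geom_ge0.
Qed.

Let factor_low a i n : (n < i)%N -> factor a i n = (n == 0%N)%:R.
Proof.
move=> ni; have i0 : (0 < i)%N := leq_ltn_trans (leq0n n) ni.
rewrite /factor; elim: (M * a i)%N n ni => [|k IH] n ni //=.
rewrite /fps_mul big_ord_recl /= fps_inv_1subX // dvdn0 mul1r subn0 IH //.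
rewrite big1 ?addr0 // => j _; rewrite fps_inv_1subX // gtnNdvd ?mul0r //.
by rewrite (leq_ltn_trans _ ni) // lift0.
Qed.

Let mul_congr (f g h k : fps int) n :
  (forall j, (j <= n)%N -> f j = g j) -> (forall j, (j <= n)%N -> h j = k j) ->
  fps_mul f h n = fps_mul g k n.
Proof.
move=> fg hk; apply: eq_bigr => j _.
by rewrite fg ?hk ?leq_subr // -ltnS.
Qed.

Let prod_low a m l n : (n < m)%N ->
  (\big[@fps_mul int/fps_one int]_(m <= i < l) factor a i) n = (n == 0%N)%:R.
Proof.
move=> nm; have [d /ltnW] := ubnP (l - m); elim: d m n nm => [|d IH] m n nm.
  by rewrite leqn0 subn_eq0 => lm; rewrite big_geq.
move=> lmd; have [lm|ml] := leqP l m; first by rewrite big_geq.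
rewrite big_ltn // /fps_mul big_ord_recl /= subn0 factor_low ?eqxx //; last first.
  exact: leq_ltn_trans nm.
rewrite mul1r IH; first 1 last.
- exact: ltnW.
- by rewrite subnS -ltnS (leq_trans _ lmd) // prednK ?subn_gt0.
rewrite big1 ?addr0 // => j _.
by rewrite factor_low ?mul0r // (leq_ltn_trans _ nm) // lift0.
Qed.

Let prod_stable a m l n s : (n < s)%N -> (s <= l)%N ->
  (\big[@fps_mul int/fps_one int]_(m <= i < l) factor a i) n =
  (\big[@fps_mul int/fps_one int]_(m <= i < s) factor a i) n.
Proof.
move=> ns sl; have [d /ltnW] := ubnP (s - m); elim: d m n ns => [|d IH] m n ns.
  rewrite leqn0 subn_eq0 => sm; rewrite [in RHS]big_geq //.
  by rewrite prod_low // (leq_trans ns).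
move=> smd; have [sm|ms] := leqP s m.
  by rewrite [in RHS]big_geq // prod_low // (leq_trans ns).
rewrite big_ltn ?(leq_trans ms) // [in RHS]big_ltn //.
apply: mul_congr => // j jn; apply: IH; first exact: leq_ltn_trans ns.
by rewrite subnS -ltnS (leq_trans _ smd) // prednK ?subn_gt0.
Qed.

Let identityE a : ark_series_identity M a <->
  forall n, (a n.+1)%:Z = partial a n n.
Proof.
split=> [H n | H n].
  have [N HN] := H n; rewrite -(HN (maxn N n)) ?leq_maxl //.
  by rewrite (@prod_stable a _ _ _ n.+1) // ltnS leq_maxr.
by exists n => m nm; rewrite H (@prod_stable a _ _ _ n.+1).
Qed.

Let eq_partial a b n : (forall i, (0 < i <= n)%N -> a i = b i) ->
  partial a n n = partial b n n.
Proof.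
move=> ab; congr (_ n); rewrite /partial big_nat_cond [RHS]big_nat_cond.
apply: eq_bigr => i; rewrite andbT ltnS => /ab E.
by rewrite /factor E.
Qed.

Lemma ark_series_unique a b :
  ark_series_identity M a -> ark_series_identity M b ->
  forall i, (0 < i)%N -> a i = b i.
Proof.
move=> /identityE Ha /identityE Hb; elim/ltn_ind => -[//|n] IH _.
apply/eqP; rewrite -eqz_nat Ha Hb; apply/eqP/eq_partial => i /andP[i0 le_in].
exact: IH.
Qed.

Let partial_ge0 a m n : 0 <= partial a m n.
Proof.
rewrite /partial big_nat_cond; elim/big_rec: _ n => [|i f] /=.
  by move=> n; rewrite /fps_one ler0n.
rewrite andbT => /andP[i0 _] IH n.
by apply: sumr_ge0 => j _; rewrite mulr_ge0 ?factor_ge0.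
Qed.

Lemma ark_series_exists : exists a, ark_series_identity M a.
Proof.
pose fix s n := if n is n'.+1 then
    rcons (s n') `|partial (nth 0%N (s n')) n' n'|%N else [:: 0%N].
have size_s n : size (s n) = n.+1 by elim: n => //= n IH; rewrite size_rcons IH.
have nth_s n j : (j <= n)%N -> nth 0%N (s n) j = nth 0%N (s j) j.
  elim: n => [|n IH]; first by rewrite leqn0 => /eqP->.
  rewrite leq_eqVlt => /predU1P[->//|]; rewrite ltnS => jn.
  by rewrite /= nth_rcons size_s ltnS jn IH.
exists (fun n => nth 0%N (s n) n); apply/identityE => n.
rewrite [s _.+1]/= nth_rcons size_s ltnn eqxx gez0_abs ?partial_ge0 //.
by apply: eq_partial => i /andP[_ le_in]; rewrite nth_s.
Qed.

End Determined.

(* Main.v *)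
From HB Require Import structures.
Require Import Defs.
From mathcomp Require Import all_boot all_order all_algebra.
From mathcomp Require Import all_fingroup.

Set Implicit Arguments.
Unset Strict Implicit.
Unset Printing Implicit Defensive.

Import GRing.Theory.
Local Open Scope nat_scope.

(** In a rooted tree every node other than the root has a unique parent, so
    that coloring the edges amounts to coloring the nodes other than the root:
    the color of an edge is moved to its lower end.  A node-colored tree is then
    an edge-colored tree together with a free color for the root, which gives
    the factor [M].  Moreover an edge-colored rooted tree is determined up to
    isomorphism by the multiset of pairs (color of the edge to a child, subtree
    at this child), so that the numbers of edge-colored trees satisfy the same
    product formula as [alpha], and this formula determines its solution.

    Both statements are obtained by counting the same finite lists.  The
    isomorphism type of a tree is encoded by a [shape], a canonical code of the
    multiset of the colored shapes below the root ([nodeP]).  The list [level n]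
    enumerates without repetition the shapes with [n.+1] nodes, and its length
    satisfies the series identity because the multisets of weight [n] over a
    list of weighted items are counted by the product of the geometric series
    of the items ([size_msets], [level_series]).

    On the side of the graphs, a tree in the sense of acyclic connected graphs is
    the same thing as a parent function with a depth ([tree_rooted],
    [link_tree]).  The shapes of the nodes are determined by a recursion towards
    the root, they are invariant under isomorphism ([risom_shape]), they
    characterize the tree ([same_shape_risom]), and all the elements of [level n]
    occur ([realize_ord]).  Hence the edge-colored classes are in bijection with
    [level n], and the node-colored ones with the pairs of an element of [level n]
    and a color ([nprk_conditionsE], [ark_conditionsE]). *)

(** * Multisets of given weight *)

Section Multisets.
Variables (X : choiceType) (wt : X -> nat).
Implicit Types (s its : seq X) (n : nat).

Definition weight s := sumn [seq wt y | y <- s].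

(** The multisets over [its] of total weight [n], each of them listed in the
    order of [its].  The index [j] is the weight contributed by the copies of
    [y], rather than their number, so that the recursion has the form of the
    product with the series of the indicator of the multiples of [wt y]. *)
Fixpoint msets its n : seq (seq X) :=
  if its is y :: its' then
    [seq nseq (j %/ wt y) y ++ s
       | j <- [seq j <- iota 0 n.+1 | wt y %| j], s <- msets its' (n - j)]
  else nseq (n == 0) [::].

Lemma msets_cons y its n :
  msets (y :: its) n =
    [seq nseq (j %/ wt y) y ++ s
       | j <- [seq j <- iota 0 n.+1 | wt y %| j], s <- msets its (n - j)].
Proof. by []. Qed.

Lemma perm_weight s s' : perm_eq s s' -> weight s = weight s'.
Proof. by move=> ss'; apply/perm_sumn/perm_map. Qed.

Lemma weight_cat s s' : weight (s ++ s') = weight s + weight s'.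
Proof. by rewrite /weight map_cat sumn_cat. Qed.

Lemma weight_nseq q y : weight (nseq q y) = q * wt y.
Proof. by rewrite /weight map_nseq sumn_nseq mulnC. Qed.

Lemma leq_weight y s : y \in s -> wt y <= weight s.
Proof. by move=> ys; rewrite (perm_weight (perm_to_rem ys)) leq_addr. Qed.

Lemma msets_sound its n s :
  s \in msets its n -> {subset s <= its} /\ weight s = n.
Proof.
elim: its n s => [|y its IH] n s.
  by case: n => [|n] //; rewrite inE => /eqP->.
rewrite msets_cons => /allpairsPdep[j [s' [+ /IH[sub w_s'] ->]]].
rewrite mem_filter mem_iota add0n ltnS.
case/andP=> jy jn; split=> [z|].
  rewrite mem_cat inE => /orP[|/sub->]; last by rewrite orbT.
  by rewrite mem_nseq => /andP[_ ->].
by rewrite weight_cat weight_nseq divnK // w_s' subnKC.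
Qed.

Lemma perm_nseq_cat y s :
  perm_eq s (nseq (count_mem y s) y ++ filter (predC1 y) s).
Proof.
have -> : nseq (count_mem y s) y = filter (pred1 y) s.
  by apply/esym; rewrite -size_filter; apply/all_pred1P/filter_all.
by rewrite perm_sym perm_filterC.
Qed.

Lemma msets_complete its s :
    (forall y, y \in its -> 0 < wt y) -> {subset s <= its} ->
  exists2 s', s' \in msets its (weight s) & perm_eq s s'.
Proof.
elim: its s => [|y its IH] s its_gt0 sub.
  by case: s sub => [|z s sub]; [exists [::] | have := sub z (mem_head _ _)].
have wy : 0 < wt y by rewrite its_gt0 ?mem_head.
have [z z_its|z|s' s'P ss'] := IH (filter (predC1 y) s).
- by rewrite its_gt0 // inE z_its orbT.
- by rewrite mem_filter => /andP[/negPf zy /sub]; rewrite inE zy.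
have ws := perm_weight (perm_nseq_cat y s).
exists (nseq (count_mem y s) y ++ s'); last first.
  by rewrite (perm_trans (perm_nseq_cat y s)) // perm_cat2l.
apply/allpairsPdep; exists (count_mem y s * wt y), s'; split=> //.
- rewrite mem_filter dvdn_mull // mem_iota ltnS ws weight_cat weight_nseq.
  exact: leq_addr.
- by rewrite ws weight_cat weight_nseq addKn.
- by rewrite mulnK.
Qed.

(** As [y] occurs in neither [s] nor [s'], its multiplicity determines [j]. *)
Lemma perm_nseq_cat_inj y j j' s s' : wt y %| j -> wt y %| j' ->
    y \notin s -> y \notin s' ->
    perm_eq (nseq (j %/ wt y) y ++ s) (nseq (j' %/ wt y) y ++ s') ->
  j = j' /\ perm_eq s s'.
Proof.
move=> dj dj' ys ys' ss'.
have jj' : j %/ wt y = j' %/ wt y.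
  move/seq.permP: (ss') => /(_ (pred1 y)); rewrite !count_cat.
  rewrite !count_nseq /= eqxx !mul1n.
  by rewrite (count_memPn ys) (count_memPn ys') !addn0.
split; first by rewrite -(divnK dj) jj' divnK.
by move: ss'; rewrite jj' perm_cat2l.
Qed.

Lemma msets_notin y its n s : y \notin its -> s \in msets its n -> y \notin s.
Proof. by move=> y_its sP; apply: contra y_its => /(proj1 (msets_sound sP)). Qed.

(** Every multiset is listed only once. *)
Lemma msets_perm_inj its n : uniq its ->
  {in msets its n &, forall s s', perm_eq s s' -> s = s'}.
Proof.
elim: its n => [|y its IH] n.
  by case: n => //= _ s s'; rewrite !inE => /eqP-> /eqP->.
rewrite msets_cons cons_uniq => /andP[y_its its_uniq] _ _
  /allpairsPdep[j [s [+ sP ->]]] /allpairsPdep[j' [s' [+ s'P ->]]].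
rewrite !mem_filter => /andP[dj _] /andP[dj' _].
case/perm_nseq_cat_inj=> //; [exact: msets_notin sP | exact: msets_notin s'P |].
move=> jj' ss'.
by subst j'; rewrite (IH _ its_uniq s s' sP s'P).
Qed.

Lemma msets_uniq its n : uniq its -> uniq (msets its n).
Proof.
elim: its n => [|y its IH] n; first by case: n.
rewrite msets_cons cons_uniq => /andP[y_its its_uniq]; apply: allpairs_uniq_dep.
- by rewrite filter_uniq ?iota_uniq.
- by move=> j _; apply: IH.
move=> _ _ /allpairsPdep[j [s [+ sP ->]]] /allpairsPdep[j' [s' [+ s'P ->]]] /=.
rewrite !mem_filter => /andP[dj _] /andP[dj' _].
move=> E; case: (@perm_nseq_cat_inj y j j' s s') => //.
- exact: msets_notin sP.
- exact: msets_notin s'P.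
- by rewrite E.
move=> jj' _; subst j'; congr Tagged.
by move/eqP: E; rewrite eqseq_cat // => /andP[_ /eqP].
Qed.

End Multisets.

(** * Generating series of the multisets *)

Section Series.
Local Open Scope ring_scope.

(** Up to a given degree, a formal power series can be replaced by a polynomial,
    for which associativity is known. *)
Lemma fps_mulA (R : comUnitRingType) (f g h : fps R) :
  fps_mul f (fps_mul g h) =1 fps_mul (fps_mul f g) h.
Proof.
move=> n; pose P (f : fps R) := \poly_(i < n.+1) f i.
have PE f' i : (i <= n)%N -> (P f')`_i = f' i.
  by move=> le_in; rewrite coef_poly ltnS le_in.
have mulE f' g' i : (i <= n)%N -> fps_mul f' g' i = (P f' * P g')`_i.
  move=> le_in; rewrite coefM; apply: eq_bigr => j _.
  rewrite !PE ?(leq_trans (leq_subr _ _)) //.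
  by rewrite (leq_trans _ le_in) // -ltnS.
transitivity ((P f * (P g * P h))`_n).
  rewrite coefM; apply: eq_bigr => j _.
  by rewrite mulE ?leq_subr // PE // -ltnS.
rewrite mulrA coefM; apply: eq_bigr => j _.
by rewrite mulE -1?ltnS // PE ?leq_subr.
Qed.

Lemma fps_mul1 (R : comUnitRingType) (f : fps R) : fps_mul (fps_one R) f =1 f.
Proof.
move=> n; rewrite /fps_mul big_ord_recl /= subn0 mul1r big1 ?addr0 // => j _.
by rewrite /fps_one mul0r.
Qed.

Lemma eq_fps_mul (R : comUnitRingType) (f f' g g' : fps R) :
  f =1 f' -> g =1 g' -> fps_mul f g =1 fps_mul f' g'.
Proof. by move=> ff' gg' n; apply: eq_bigr => j _; rewrite ff' gg'. Qed.

Definition geometric (i : nat) : fps int := fps_inv (fps_1subX int i).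

Variables (X : choiceType) (wt : X -> nat).

Definition items_series (its : seq X) : fps int :=
  foldr (fun y => fps_mul (geometric (wt y))) (fps_one int) its.

(** The coefficients of [geometric i] are the indicator of the multiples of [i],
    and a choice of the copies of one item is a choice of such a multiple. *)
Lemma size_msets (its : seq X) n : (forall y, y \in its -> 0 < wt y)%N ->
  (size (msets wt its n))%:Z = items_series its n.
Proof.
elim: its n => [|y its IH] n its_gt0; first by case: n.
rewrite msets_cons size_allpairs_dep sumnE big_map big_filter.
rewrite -[iota _ _]/(index_iota 0 n.+1) big_mkord.
rewrite -natz natr_sum /= /fps_mul big_mkcond /=.
apply: eq_bigr => j _.
rewrite /geometric fps_inv_1subX ?its_gt0 ?mem_head //.
case: (wt y %| j)%N; rewrite ?mul0r // mul1r natz IH // => z z_its.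
by rewrite its_gt0 // inE z_its orbT.
Qed.

Lemma items_series_cat s1 s2 :
  items_series (s1 ++ s2) =1 fps_mul (items_series s1) (items_series s2).
Proof.
elim: s1 => [|y s1 IH] n /=; first by rewrite fps_mul1.
by rewrite -fps_mulA; apply: eq_fps_mul.
Qed.

Lemma items_series_block i its : (forall y, y \in its -> wt y = i) ->
  items_series its = fps_exp (geometric i) (size its).
Proof.
elim: its => //= y its IH its_i; rewrite its_i ?mem_head // IH // => z z_its.
by rewrite its_i // inE z_its orbT.
Qed.

Lemma items_series_flatten (r : seq nat) (B : nat -> seq X) :
    (forall i y, y \in B i -> wt y = i) ->
  items_series (flatten [seq B i | i <- r]) =1
  \big[@fps_mul int/fps_one int]_(i <- r) fps_exp (geometric i) (size (B i)).
Proof.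
move=> BP; elim: r => [|i r IH] n; first by rewrite big_nil.
rewrite big_cons /= items_series_cat; apply: eq_fps_mul => //.
by rewrite (items_series_block (@BP i)).
Qed.

End Series.

(** * Shapes of colored rooted trees *)

Section Shapes.
Variable C : finType.

(** The code of an isomorphism type of trees: the number of nodes, and a natural
    number that encodes the multiset of the colored shapes of the children of
    the root.  Encoding it in [nat] closes the recursion without a nested
    inductive type. *)
Definition shape : Type := (nat * nat)%type.
(** A child of a node: its shape, and the color of the edge that leads to it. *)
Definition item : Type := (shape * C)%type.
HB.instance Definition _ := Countable.on shape.
HB.instance Definition _ := Countable.on item.

Definition shape_size (x : shape) : nat := x.1.
Definition item_size (y : item) : nat := shape_size y.1.

(** [choose (perm_eq s) s] depends only on the class of [s] under permutations,
    because the choice depends only on the extension of the predicate. *)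
Definition node (s : seq item) : shape :=
  ((weight item_size s).+1, pickle (choose (perm_eq s) s)).

Lemma nodeP s s' : reflect (node s = node s') (perm_eq s s').
Proof.
apply: (iffP idP) => [ss' | [_ /(pcan_inj pickleK) E]].
  congr pair; first by rewrite (perm_weight _ ss').
  congr pickle; rewrite (@choose_id _ _ s s' (perm_refl s) ss').
  by apply: eq_choose; exact/permPl.
rewrite (perm_trans (chooseP (perm_refl s))) // E perm_sym.
exact: (chooseP (perm_refl s')).
Qed.

Definition colored (xs : seq shape) : seq item :=
  [seq (x, c) | x <- xs, c <- enum C].

(** All the colored shapes with at most [n] nodes; those with [n.+1] nodes are
    formed from the multisets of weight [n] over the smaller ones. *)
Fixpoint items (n : nat) : seq item :=
  if n is n'.+1 then
    items n' ++ colored [seq node s | s <- msets item_size (items n') n']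
  else [::].

(** All the shapes with [n.+1] nodes. *)
Definition level (n : nat) : seq shape :=
  [seq node s | s <- msets item_size (items n) n].

Lemma itemsS n : items n.+1 = items n ++ colored (level n).
Proof. by []. Qed.

Lemma items_flatten n :
  items n = flatten [seq colored (level i.-1) | i <- iota 1 n].
Proof.
elim: n => // n IH.
by rewrite itemsS IH -[n.+1]addn1 iotaD map_cat flatten_cat /= cats0.
Qed.

Lemma level_size n x : x \in level n -> shape_size x = n.+1.
Proof. by case/mapP=> s /msets_sound[_ ws] ->; rewrite /shape_size /= ws. Qed.

Lemma mem_colored xs x c : ((x, c) \in colored xs) = (x \in xs).
Proof.
apply/allpairsP/idP => [[[x' c'] /= [xP _ [-> _]]] //|xP].
by exists (x, c); rewrite mem_enum.
Qed.

Lemma mem_items n x c :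
  ((x, c) \in items n) = (shape_size x <= n) && (x \in level (shape_size x).-1).
Proof.
elim: n => [|n IH].
  rewrite leqn0 in_nil; apply/esym; apply/andP => -[/eqP x0] /level_size.
  by rewrite x0.
rewrite itemsS mem_cat {}IH mem_colored [in RHS]leq_eqVlt ltnS.
have [xn|xn] := eqVneq (shape_size x) n.+1; first by rewrite xn ltnn /=.
rewrite /=; case: (boolP (x \in level n)) => [/level_size/eqP|]; last
  by rewrite orbF.
by rewrite (negPf xn).
Qed.

Lemma items_gt0 n y : y \in items n -> 0 < item_size y.
Proof.
case: y => x c; rewrite mem_items => /andP[_ /level_size].
by rewrite /item_size /= => ->.
Qed.

Lemma uniq_nodes n its :
  uniq its -> uniq [seq node s | s <- msets item_size its n].
Proof.
move=> its_uniq; rewrite map_inj_in_uniq ?msets_uniq // => s s' sP s'P /nodeP.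
exact: msets_perm_inj its_uniq _ _ sP s'P.
Qed.

Lemma items_uniq n : uniq (items n).
Proof.
elim: n => // n IH.
rewrite itemsS cat_uniq IH allpairs_uniq ?uniq_nodes ?enum_uniq //=.
  rewrite andbT; apply/hasPn => -[x c]; rewrite mem_colored => /level_size xn.
  by rewrite mem_items xn ltnn.
by move=> [? ?] [? ?] _ _.
Qed.

Lemma level_uniq n : uniq (level n).
Proof. exact/uniq_nodes/items_uniq. Qed.

Lemma node_level s :
    (forall y, y \in s -> y.1 \in level (shape_size y.1).-1) ->
  forall m, weight item_size s <= m ->
  node s \in [seq node s' | s' <- msets item_size (items m) (weight item_size s)].
Proof.
move=> sP m le_m.
have [|y ys|s' s'P ss'] := @msets_complete _ item_size (items m) s.
- exact: items_gt0.
- have := sP y ys; case: y ys => x c ys xP; rewrite mem_items xP andbT.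
  by apply: leq_trans le_m; apply: (@leq_weight _ item_size (x, c)).
by apply/mapP; exists s' => //; apply/nodeP.
Qed.

(** The items of size greater than [n] cannot occur in a multiset of weight [n],
    so that the finite products of the series stabilize. *)
Lemma nodes_level n m : n <= m ->
  [seq node s | s <- msets item_size (items m) n] =i level n.
Proof.
move=> le_nm; have sub k l : n <= l ->
  {subset [seq node s | s <- msets item_size (items k) n] <=
          [seq node s | s <- msets item_size (items l) n]}.
  move=> nl _ /mapP[s /msets_sound[sub ws] ->]; rewrite -{1}ws.
  apply: node_level => [[x c] /sub|]; last by rewrite ws.
  by rewrite mem_items => /andP[_ ->].
by move=> x; apply/idP/idP; apply: sub.
Qed.

Local Open Scope ring_scope.

Lemma level_series n m : (n <= m)%N ->
  (size (level n))%:Z =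
  (\big[@fps_mul int/fps_one int]_(1 <= i < m.+1)
     fps_exp (fps_inv (fps_1subX int i)) (#|C| * size (level i.-1))) n.
Proof.
move=> le_nm.
have <- : size (msets item_size (items m) n) = size (level n).
  rewrite -(size_map node); apply/perm_size/uniq_perm; rewrite ?level_uniq //.
    exact/uniq_nodes/items_uniq.
  exact: nodes_level.
rewrite size_msets => [|y]; last exact: items_gt0.
rewrite items_flatten /index_iota subSS subn0.
(* The block of index 0, which does not occur, is emptied so that the items
   of block [i] have size [i] for every [i]. *)
have -> : [seq colored (level i.-1) | i <- iota 1 m] =
  [seq (if i is 0 then [::] else colored (level i.-1)) | i <- iota 1 m].
  by apply/eq_in_map => -[|i]; rewrite ?mem_iota.
rewrite items_series_flatten => [|[|i] [x c] //]; last first.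
  by rewrite mem_colored => /level_size.
congr (_ n); rewrite big_seq [RHS]big_seq; apply: eq_bigr => -[|i].
  by rewrite mem_iota.
by rewrite size_allpairs -cardE mulnC.
Qed.

End Shapes.

(** * Trees given by a parent function *)

(** For node-colored trees [col x] is the color of [x], for edge-colored ones the
    color of the edge from [x] to [par x]. *)
Record rtree (C T : Type) := RTree { top : T; par : T -> T; col : T -> C }.

Section RootedTrees.
Variables (C T : finType) (R : rtree C T).

(** The depth function [d] ensures that every node reaches the root. *)
Definition rooted : Prop :=
  exists2 d : T -> nat, d (top R) = 0 &
    forall x, x != top R -> d x = (d (par R x)).+1.

Definition kids v := [seq w <- enum T | (w != top R) && (par R w == v)].

Lemma mem_kids v w : (w \in kids v) = (w != top R) && (par R w == v).
Proof. by rewrite mem_filter mem_enum andbT. Qed.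

Lemma kids_uniq v : uniq (kids v).
Proof. by rewrite filter_uniq ?enum_uniq. Qed.

Lemma root_ind (P : T -> Prop) : rooted -> P (top R) ->
  (forall x, x != top R -> P (par R x) -> P x) -> forall x, P x.
Proof.
move=> [d _ dP] P0 PS x; have [n] := ubnP (d x); elim: n x => // n IH x.
have [->|xr] := eqVneq x (top R); first by [].
by rewrite dP // ltnS => /IH; apply: PS.
Qed.

(** Induction towards the root: the depth is bounded since [T] is finite. *)
Lemma kids_ind (P : T -> Prop) : rooted ->
  (forall v, (forall w, w \in kids v -> P w) -> P v) -> forall v, P v.
Proof.
move=> [d _ dP] PS v; pose B := \max_x d x.
have [n] := ubnP (B - d v); elim: n v => // n IH v le_n; apply: PS => w.
rewrite mem_kids => /andP[wr /eqP pw]; apply: IH.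
have dw := dP w wr; rewrite pw in dw.
have dB : d w <= B by apply: leq_bigmax.
by rewrite -ltnS (leq_trans _ le_n) // ltnS ltn_sub2l //
  -?dw // (leq_trans _ dB) // dw.
Qed.

(** [sh] assigns to every node the shape of the subtree below it. *)
Definition shaped (sh : T -> shape) : Prop :=
  forall v, sh v = node [seq (sh w, col R w) | w <- kids v].

Lemma shaped_exists : rooted -> exists sh, shaped sh.
Proof.
move=> [d _ dP]; pose B := (\max_x d x).+1.
(* The fuel [B - d v] is positive at every node [v], so that the value of
   [code] for the fuel 0 is a mere default. *)
pose code := fix code k v := if k is k'.+1
  then node [seq (code k' w, col R w) | w <- kids v] else (0, 0).
exists (fun v => code (B - d v) v) => v.
have dB x : d x < B by rewrite ltnS leq_bigmax.
rewrite -(subSS (d v)) (subSn (dB v)) /=; congr node; apply/eq_in_map => w.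
by rewrite mem_kids => /andP[/dP-> /eqP->].
Qed.

(** Summing the recursion for the sizes over all the nodes gives every node once,
    and the size at every node but the root on both sides. *)
Lemma shape_size_card sh : shaped sh -> shape_size (sh (top R)) = #|T|.
Proof.
move=> shP; apply/eqP.
rewrite -(eqn_add2r (\sum_(w | w != top R) shape_size (sh w))).
apply/eqP; transitivity (\sum_v shape_size (sh v)).
  by rewrite [RHS](bigD1 (top R)).
transitivity (
  \sum_v (1 + \sum_(w | (w != top R) && (par R w == v)) shape_size (sh w))).
  apply: eq_bigr => v _; rewrite {1}shP /shape_size /= /weight.
  by rewrite -map_comp sumnE big_map big_filter big_enum_cond /= add1n.
by rewrite big_split /= sum1_card -partition_big.
Qed.

Lemma shape_level sh : rooted -> shaped sh ->
  forall v, sh v \in level C (shape_size (sh v)).-1.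
Proof.
move=> Rr shP; apply: (kids_ind Rr) => v IH; rewrite (shP v) /level /=.
by apply: node_level => // y /mapP[w /IH wP ->].
Qed.

End RootedTrees.

Section Morphisms.
Variables (C T T' : finType) (R : rtree C T) (R' : rtree C T').

(** The colors of the roots may differ, so that these are the isomorphisms of
    edge-colored trees. *)
Definition risom (f : T -> T') : Prop :=
  [/\ bijective f, f (top R) = top R' &
      forall x, x != top R ->
        par R' (f x) = f (par R x) /\ col R' (f x) = col R x].

Lemma perm_kids f v : risom f -> perm_eq (kids R' (f v)) (map f (kids R v)).
Proof.
move=> [f_bij f0 fP]; have f_inj := bij_inj f_bij; have [g gK Kg] := f_bij.
apply: uniq_perm; rewrite ?map_inj_uniq ?kids_uniq // => y; rewrite -(Kg y).
rewrite mem_map // !mem_kids -f0 (inj_eq f_inj).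
by apply: andb_id2l => /fP[-> _]; rewrite inj_eq.
Qed.

Lemma risom_shape f sh sh' :
    rooted R -> risom f -> shaped R sh -> shaped R' sh' ->
  forall v, sh' (f v) = sh v.
Proof.
move=> Rr fP shP shP'; apply: (kids_ind Rr) => v IH; rewrite shP shP'.
apply/nodeP; have [_ _ fP'] := fP.
rewrite (perm_trans (perm_map _ (perm_kids v fP))) // -map_comp.
suff -> : [seq (sh w, col R w) | w <- kids R v] =
          [seq (sh' (f w), col R' (f w)) | w <- kids R v] by [].
apply/eq_in_map => w wv; rewrite IH //.
by move: wv; rewrite mem_kids => /andP[/fP'[_ ->]].
Qed.

End Morphisms.

(** The matching is one of the indices, since [f] and [g] may repeat values; it is
    built by induction, removing from [t] the index chosen for the head of [s]. *)
Lemma perm_map_matching (A B : finType) (X : eqType)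
    (f : A -> X) (g : B -> X) s t (b0 : B) :
    uniq s -> uniq t -> perm_eq (map f s) (map g t) ->
  exists h : A -> B,
    {in s, forall x, h x \in t /\ g (h x) = f x} /\ {in s &, injective h}.
Proof.
elim: s t => [|a s IH] t /=; first by exists (fun=> b0).
case/andP=> a_s s_uniq t_uniq st.
have /mapP[b b_t fa] : f a \in map g t by rewrite -(perm_mem st) mem_head.
have tP := perm_to_rem b_t.
have [||h [hP h_inj]] := IH (rem b t) s_uniq; first exact: rem_uniq.
  by rewrite -(perm_cons (f a)) (perm_trans st) // fa -map_cons perm_map.
exists (fun x => if x == a then b else h x); split=> [x|x y].
  rewrite inE; case: eqP => [->|_ /= /hP[/mem_rem ? ?]] //.
rewrite !inE; have hb z : z \in s -> b <> h z.
  by move=> /hP[+ _] bz; rewrite -bz mem_rem_uniq // inE eqxx.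
case: eqP => [->|_] /=; case: eqP => [->|_] //=.
- by move=> _ /hb bz /bz.
- by move=> /hb bz _ /esym /bz.
- exact: h_inj.
Qed.

(** When two nodes have the same shape, the children of the one can be matched
    with those of the other, preserving shapes and colors.  Following these
    matchings from the root downwards defines a map between the trees.  It is
    injective because equal images have equal parents, hence by induction come
    from children of one node, where the matching is injective.  The two node
    sets being equal and finite, it is bijective. *)
Lemma same_shape_risom (C T : finType) (R R' : rtree C T) sh sh' :
    rooted R -> rooted R' -> shaped R sh -> shaped R' sh' ->
  sh (top R) = sh' (top R') -> exists f, risom R R' f.
Proof.
move=> Rr Rr' shP shP' sh0.
(* [h (v, v')] matches the children of [v] with those of [v']. *)
pose good v v' (h : T -> T) := sh v = sh' v' ->
  {in kids R v, forall w,
     [/\ h w \in kids R' v', sh' (h w) = sh w & col R' (h w) = col R w]}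
  /\ {in kids R v &, injective h}.
have [h hP] : exists h : T * T -> {ffun T -> T}, forall vv, good vv.1 vv.2 (h vv).
  apply: (fin_all_exists (P := fun vv (h : {ffun T -> T}) => good vv.1 vv.2 h)).
  move=> -[v v'] /=.
  have [|ne] := eqVneq (sh v) (sh' v'); last first.
    by exists [ffun=> v] => /eqP; rewrite (negPf ne).
  rewrite shP shP' => /nodeP/(perm_map_matching v)[||h [hP h_inj]];
    rewrite ?kids_uniq //.
  exists (finfun h) => _; split=> [w /hP[hw [shw colw]]|w w' wv wv'];
    rewrite !ffunE //.
  exact: h_inj.
(* [F x] is obtained from [F (par R x)] by the matching of the children of
   [par R x]; [G] defines it by recursion on the depth of [x]. *)
have [d _ dP] := Rr.
pose G := fix G k x := if k is k'.+1
  then if x == top R then top R' else h (par R x, G k' (par R x)) x else top R'.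
pose F x := G (d x) x.
have F0 : F (top R) = top R' by rewrite /F; case: (d _) => //= n; rewrite eqxx.
have FS x : x != top R -> F x = h (par R x, F (par R x)) x.
  by move=> xr; rewrite {1}/F dP //= (negPf xr).
have shF : forall x, sh x = sh' (F x).
  apply: (root_ind Rr) => [|x xr IH]; first by rewrite F0.
  by have [/(_ x) + _] := hP (_, _) IH; rewrite mem_kids xr eqxx -(FS x xr) => -[].
have FP x : x != top R ->
    [/\ F x != top R', par R' (F x) = F (par R x) & col R' (F x) = col R x].
  move=> xr; have [/(_ x) + _] := hP (_, _) (shF (par R x)).
  by rewrite mem_kids xr eqxx -(FS x xr) mem_kids => -[] // /andP[? /eqP].
have F_inj : injective F.
  move=> x; apply: (root_ind Rr (P := fun x => forall y, F x = F y -> x = y)) x.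
    move=> y; have [-> //|/FP[+ _ _]] := eqVneq y (top R).
    by rewrite F0 => /negP + E; rewrite E eqxx.
  move=> x xr IH y Fxy; have [Fx px _] := FP x xr.
  have yr : y != top R by apply: contraNneq Fx => y0; rewrite Fxy y0 F0.
  have [_ py _] := FP y yr.
  have pxy : par R x = par R y by apply: IH; rewrite -px -py Fxy.
  have [_] := hP (_, _) (shF (par R x)); apply;
    rewrite ?mem_kids ?xr ?yr -?pxy ?eqxx //.
  by rewrite -(FS x xr) Fxy (FS y yr) pxy.
exists F; split=> //; first exact: injF_bij.
by move=> x /FP[].
Qed.

(** * Every shape is the shape of a tree *)

Section Realization.
Variable C : finType.

(** [R2] is attached below the root of [R1] by an edge of color [c]. *)
Definition graft (T1 T2 : finType) (R1 : rtree C T1) (R2 : rtree C T2) (c : C) :=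
  RTree (inl (top R1))
    (fun z => match z with
              | inl x => inl (par R1 x)
              | inr y => if y == top R2 then inl (top R1) else inr (par R2 y) end)
    (fun z => match z with
              | inl x => col R1 x
              | inr y => if y == top R2 then c else col R2 y end).

Lemma enum_sum (T1 T2 : finType) :
  enum ((T1 + T2)%type : finType) = map inl (enum T1) ++ map inr (enum T2).
Proof. by rewrite !enumT [in LHS]unlock. Qed.

Lemma graft_rooted (T1 T2 : finType) (R1 : rtree C T1) (R2 : rtree C T2) c :
  rooted R1 -> rooted R2 -> rooted (graft R1 R2 c).
Proof.
move=> [d1 d10 d1P] [d2 d20 d2P].
exists (fun z => match z with inl x => d1 x | inr y => (d2 y).+1 end) => //.
case=> [x|y _ /=]; first by move=> xr; apply: d1P; apply: contra_neq xr => /= ->.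
by case: eqVneq => [->|/d2P->]; rewrite ?d20 ?d10.
Qed.

Lemma kids_graft_inl (T1 T2 : finType) (R1 : rtree C T1) (R2 : rtree C T2) c v :
  kids (graft R1 R2 c) (inl v) =
  map inl (kids R1 v) ++ (if v == top R1 then [:: inr (top R2)] else [::]).
Proof.
rewrite /kids enum_sum filter_cat (@filter_map _ _ inl) (@filter_map _ _ inr).
congr (map _ _ ++ _).
case: eqVneq => [->|vr].
  rewrite (eq_filter (a2 := pred1 (top R2))) => [|y /=]; last first.
    by case: (eqVneq y) => _; rewrite ?eqxx.
  by rewrite filter_pred1_uniq ?enum_uniq ?mem_enum.
rewrite (eq_filter (a2 := pred0)) ?filter_pred0 // => y /=.
by case: (eqVneq y) => // _; apply/negbTE; apply: contra vr => /eqP[->].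
Qed.

Lemma kids_graft_inr (T1 T2 : finType) (R1 : rtree C T1) (R2 : rtree C T2) c v :
  kids (graft R1 R2 c) (inr v) = map inr (kids R2 v).
Proof.
rewrite /kids enum_sum filter_cat (@filter_map _ _ inl) (@filter_map _ _ inr).
rewrite (eq_filter (a2 := pred0)); last first.
  by move=> x /=; rewrite andbF.
rewrite filter_pred0 /=; congr map; apply: eq_filter => y /=.
by case: (eqVneq y).
Qed.

(** The color of the root, which the shape does not record, is prescribed: it is
    needed for node-colored trees. *)
Definition realizable (x : shape) (a : C) : Prop :=
  exists (T : finType) (R : rtree C T) (sh : T -> shape),
    [/\ rooted R, shaped R sh, sh (top R) = x & col R (top R) = a].

Lemma realize_graft (s : seq (item C)) x c a :
  realizable (node s) a -> realizable x a -> realizable (node ((x, c) :: s)) a.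
Proof.
move=> [T1 [R1 [sh1 [Rr1 sh1P sh1s col1]]]] [T2 [R2 [sh2 [Rr2 sh2P sh2x _]]]].
(* Only the root of [T1] gets a new shape, as it gains a child. *)
pose sh z := match z with
  | inl v => if v == top R1 then node ((x, c) :: s) else sh1 v
  | inr v => sh2 v end.
exists (T1 + T2)%type, (graft R1 R2 c), sh; split=> //=; last by rewrite eqxx.
  exact: graft_rooted.
case=> v; last first.
  rewrite kids_graft_inr -map_comp /= sh2P; congr node; apply/eq_in_map => w /=.
  by rewrite mem_kids => /andP[/negPf->].
rewrite kids_graft_inl map_cat -map_comp /=.
have -> :
  [seq ((fun w => (sh w, col (graft R1 R2 c) w)) \o inl) w | w <- kids R1 v] =
          [seq (sh1 w, col R1 w) | w <- kids R1 v].
  by apply/eq_in_map => w /=; rewrite mem_kids => /andP[/negPf->].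
case: eqVneq => [->|vr]; last by rewrite cats0 sh1P.
apply/nodeP; rewrite /= eqxx sh2x perm_sym perm_catC /= perm_cons perm_sym.
by apply/nodeP; rewrite -sh1s sh1P.
Qed.

Lemma realize_leaf a : realizable (node (C := C) [::]) a.
Proof.
exists unit, (RTree tt id (fun=> a)), (fun=> node (C := C) [::]); split=> //.
  by exists (fun=> 0) => // -[].
by case; rewrite /kids (eq_filter (a2 := pred0)) ?filter_pred0 //; case.
Qed.

(** A tree is grown from its root by grafting the children one after the other. *)
Lemma realize_level n x a : x \in level C n -> realizable x a.
Proof.
elim/ltn_ind: n x => n IH _ /mapP[s /msets_sound[sub _] ->].
elim: s sub => [|[x c] s IHs] sub; first exact: realize_leaf.
apply: realize_graft; first by apply: IHs => y ys; rewrite sub // inE ys orbT.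
have := sub _ (mem_head _ _); rewrite mem_items => /andP[xn xP].
by apply: (IH _ _ _ xP); rewrite prednK // (level_size xP).
Qed.

(** The nodes of a tree are renumbered by ['I_n.+1]. *)
Lemma realize_ord n x a : x \in level C n ->
  exists (R : rtree C 'I_n.+1) sh,
    [/\ rooted R, shaped R sh, sh (top R) = x & col R (top R) = a].
Proof.
move=> xn; have [T [R [sh [Rr shP shx cola]]]] := realize_level a xn.
have cardT : #|T| = n.+1 by rewrite -(shape_size_card shP) shx (level_size xn).
pose f x := cast_ord cardT (enum_rank x).
pose g i := enum_val (cast_ord (esym cardT) i).
have fK : cancel f g by move=> y; rewrite /f /g cast_ordK enum_rankK.
have gK : cancel g f by move=> y; rewrite /f /g enum_valK cast_ordKV.
pose R' := RTree (f (top R)) (f \o par R \o g) (col R \o g).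
have fP : risom R R' f by split=> [||v _]; rewrite /= ?fK //; exists g.
have Rr' : rooted R'.
  have [d d0 dP] := Rr; exists (d \o g) => [|v vr] /=; rewrite fK // dP //.
  by apply: contra_neq vr => /= <-; rewrite gK.
have [sh' sh'P] := shaped_exists Rr'.
exists R', sh'; split=> //; last by rewrite /= fK.
by rewrite -shx -(risom_shape Rr fP shP sh'P); have [_ ->] := fP.
Qed.

End Realization.

(** * Trees as acyclic connected graphs *)

Lemma acyclicP (T : finType) (e : rel T) :
  reflect (forall s, 2 < size s -> ~~ ucycleb e s) (acyclic e).
Proof.
apply: (iffP forallP) => [acyc s s2 | acyc k].
  apply/negP => s_cyc.
  have sT : size s < #|T|.+1.
    by rewrite ltnS; have /andP[_ /card_uniqP <-] := s_cyc; apply: max_card.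
  have /forallP/(_ (in_tuple s)) := acyc (Ordinal sT).
  by rewrite /= s2 s_cyc.
by apply/forallP=> s; apply/implyP=> k2; apply: acyc; rewrite size_tuple.
Qed.

Section Links.
Variables (C T : finType).
Implicit Types R : rtree C T.

(** The edges of the tree, which join the nodes to their parents. *)
Definition link R : rel T := fun x y =>
  (x != top R) && (par R x == y) || (y != top R) && (par R y == x).

Lemma link_sym R : symmetric (link R).
Proof. by move=> x y; rewrite /link orbC. Qed.

(** In a cycle, both neighbors of a node of maximal depth are its parent, hence
    they are equal, which the length of the cycle excludes. *)
Lemma link_tree R : rooted R -> is_tree (link R).
Proof.
move=> Rr; have [d _ dP] := Rr; apply/and4P; split.
- apply/forallP=> x; rewrite /link orbb; apply/negP => /andP[/dP dx /eqP px].
  by move: dx; rewrite px => /n_Sn.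
- by apply/forallP=> x; apply/forallP=> y; rewrite link_sym.
- have to_top : forall x, connect (link R) x (top R).
    apply: (root_ind Rr) => [|x xr]; first exact: connect0.
    by apply: connect_trans; apply: connect1; rewrite /link xr eqxx.
  apply/forallP=> x; apply/forallP=> y; apply: connect_trans (to_top x) _.
  by rewrite (sym_connect_sym (@link_sym R)).
apply/acyclicP => s s2; apply/negP => s_cyc.
case: s => // x0 s in s2 s_cyc *.
case: (@arg_maxnP _ x0 (mem (x0 :: s)) d (mem_head _ _)) => x xs x_max.
have x_par y : y \in x0 :: s -> link R x y -> y = par R x.
  move=> /x_max /= dy /orP[] /andP[yr /eqP E] //.
  by move: dy; rewrite (dP y yr) E ltnn.
have [i s' rot_s] := rot_to xs.
have s'P : {subset x :: s' <= x0 :: s} by move=> y; rewrite -rot_s mem_rot.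
have s'2 : 2 < size (x :: s') by rewrite -rot_s size_rot.
have : ucycle (link R) (x :: s') by rewrite -rot_s rot_ucycle.
case: s' {rot_s} s'P s'2 => // y; case/lastP=> // s' z s'P _.
rewrite /ucycle /= rcons_path last_rcons => /andP[/andP[xy /andP[_ zx]]].
rewrite mem_rcons inE !negb_or => /and3P[_ /andP[/eqP yz _] _]; apply: yz.
have -> : y = par R x by apply: x_par xy; apply: s'P; rewrite !inE eqxx orbT.
apply/esym/x_par; last by rewrite link_sym.
by apply: s'P; rewrite !inE mem_rcons mem_head !orbT.
Qed.

End Links.

(** The parent of a node is a neighbor closer to the root [r].  If an edge did not
    join a node to its parent, its ends would still be connected through the
    root after the removal of this edge, and a path between them would close up
    to a cycle. *)
Lemma tree_rooted (T : finType) (e : rel T) (r : T) : is_tree e ->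
  exists p : T -> T, forall (C : finType) (col : T -> C),
    let R := RTree r p col in rooted R /\ e =2 link R.
Proof.
case/and4P=> /forallP e_irr /forallP e_symP /forallP e_conn /acyclicP e_acyc.
have e_sym : symmetric e.
  by move=> x y; apply/eqP; have /forallP := e_symP x; apply.
pose walk x n := [exists s : n.-tuple T, path e x s && (last x s == r)].
have walkP x s : path e x s -> last x s = r -> walk x (size s).
  by move=> es sr; apply/existsP; exists (in_tuple s); rewrite /= es sr eqxx.
have walk_ex x : exists n, walk x n.
  have /forallP/(_ r)/connectP[s es sr] := e_conn x.
  by exists (size s); apply: walkP.
pose d x := ex_minn (walk_ex x).
have d_min x s : path e x s -> last x s = r -> d x <= size s.
  by move=> es sr; rewrite /d; case: ex_minnP => n _; apply; apply: walkP.
have dP x : exists2 s, path e x s /\ last x s = r & size s = d x.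
  rewrite /d; case: ex_minnP => n /existsP[s /andP[es /eqP sr]] _.
  by exists s; rewrite ?size_tuple.
have d0 : d r = 0 by apply/eqP; rewrite -leqn0 (d_min r [::]).
have [p pP] : exists p : T -> T,
    forall x, x != r -> e x (p x) /\ d x = (d (p x)).+1.
  apply: (fin_all_exists (P := fun x y => x != r -> e x y /\ d x = (d y).+1)) => x.
  have [[|y s] [es sr] ds] := dP x; first by exists x; rewrite -sr eqxx.
  move: es => /= /andP[xy es]; exists y => _; split=> //; apply/eqP.
  rewrite eqn_leq -{2}ds ltnS (d_min y s) // andbT.
  have [s' [es' s'r] <-] := dP y.
  by apply: (d_min x (y :: s')) => //=; rewrite xy.
exists p => C col R; have Rr : rooted R by exists d => // x /pP[].
split=> // x y; apply/idP/idP => [exy | /orP[] /andP[/pP[ep _] /eqP<-] //];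
  last first.
  by rewrite e_sym.
apply/negPn/negP; rewrite negb_or !negb_and /= => /andP[nx ny].
(* [e'] is [e] without the edge between [x] and [y]. *)
pose e' u v := e u v && ~~ ((u == x) && (v == y) || (u == y) && (v == x)).
have e'_sym : symmetric e'.
  by move=> u v; rewrite /e' e_sym orbC; congr (_ && ~~ (_ || _)); rewrite andbC.
have to_r : forall z, connect e' z r.
  apply: (root_ind Rr) => [|z zr]; first exact: connect0.
  apply: connect_trans; apply: connect1; rewrite /e' (proj1 (pP z zr)) /=.
  apply/norP; split; apply/andP => -[/eqP zx /eqP pz].
    by move: nx; rewrite -zx zr pz eqxx.
  by move: ny; rewrite -zx zr pz eqxx.
have : connect e' x y.
  by rewrite (connect_trans (to_r x)) // (sym_connect_sym e'_sym).
case/connectP=> s es; case/shortenP: es => s' es' s'_uniq _ ys'.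
have s'2 : 2 < size (x :: s').
  case: s' es' s'_uniq ys' => [|z [|//]] /=; first
    by move=> _ _ yx; rewrite yx (negPf (e_irr x)) in exy.
  by rewrite andbT => + _ yz; rewrite -yz /e' !eqxx andbF.
have /negP := e_acyc _ s'2; apply.
rewrite /ucycleb s'_uniq andbT /= rcons_path -ys' e_sym exy andbT.
by apply: sub_path es' => u v /andP[].
Qed.

(** The parents are determined by the root and the edges: a neighbor other than
    the parent is a child, and by induction the image of [par R x] cannot be a
    child of the image of [x]. *)
Lemma link_par (C T : finType) (R R' : rtree C T) (f : T -> T) :
    rooted R -> rooted R' -> injective f -> f (top R) = top R' ->
    (forall x y, link R' (f x) (f y) = link R x y) ->
  forall x, x != top R -> par R' (f x) = f (par R x).
Proof.
move=> Rr Rr' f_inj f0 fl; have [d _ dP] := Rr.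
apply: (root_ind Rr) => [|x xr IH _]; first by rewrite eqxx.
have : link R' (f x) (f (par R x)) by rewrite fl /link xr eqxx.
case/orP=> /andP[]; first by move=> _ /eqP.
rewrite -f0 (inj_eq f_inj) => pr; rewrite IH // (inj_eq f_inj) => /eqP ppx.
by have := dP x xr; rewrite (dP _ pr) ppx => /eqP;
  rewrite -addn2 -{1}(addn0 (d x)) eqn_add2l.
Qed.

Lemma risom_link (C T : finType) (R R' : rtree C T) (f : T -> T) :
  risom R R' f -> forall x y, link R' (f x) (f y) = link R x y.
Proof.
move=> [/bij_inj f_inj f0 fP] x y; rewrite /link -f0 !(inj_eq f_inj).
by congr (_ || _); apply: andb_id2l => /fP[-> _]; rewrite inj_eq.
Qed.

(** * Counting the classes *)

(** The relation [K] between the objects and their invariants in [L] induces a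
    bijection between the classes and [L]. *)
Lemma card_classes (T : finType) (X : eqType) (E : rel T) (D : {set T})
    (L : seq X) (K : T -> X -> Prop) :
    uniq L ->
    (forall t, t \in D -> exists2 x, x \in L & K t x) ->
    (forall x, x \in L -> exists2 t, t \in D & K t x) ->
    (forall t u x y, K t x -> K u y -> E t u = (x == y)) ->
  #|equivalence_partition E D| = size L.
Proof.
move=> L_uniq DL LD KE; pose l j := tnth (in_tuple L) j.
have [g gP] : exists g : 'I_(size L) -> T, forall j, g j \in D /\ K (g j) (l j).
  apply: (fin_all_exists (P := fun j t => t \in D /\ K t (l j))) => j.
  by have [t tD Kt] := LD _ (mem_tnth j (in_tuple L)); exists t.
pose B j := [set t in D | E (g j) t].
suff -> : equivalence_partition E D = [set B j | j in 'I_(size L)].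
  rewrite card_imset ?card_ord // => i j /setP/(_ (g i)).
  have [gD Ki] := gP i; rewrite !inE gD /= (KE _ _ _ _ Ki Ki) eqxx.
  have [_ Kj] := gP j; rewrite (KE _ _ _ _ Kj Ki) => /esym/eqP.
  by have /tuple_uniqP l_inj : uniq (in_tuple L) by []; move/l_inj.
have blockE t j : K t (l j) -> [set u in D | E t u] = B j.
  move=> Kt; have [_ Kj] := gP j; apply/setP => u; rewrite !inE; apply: andb_id2l.
  by move=> /DL[x _ Ku]; rewrite (KE _ _ _ _ Kt Ku) (KE _ _ _ _ Kj Ku).
apply/setP => P; apply/imsetP/imsetP => [[t tD ->]|[j _ ->]].
  have [x /(@tnthP _ _ (in_tuple L))[j ->] Kt] := DL t tD.
  by exists j => //; apply: blockE.
by have [gD Kj] := gP j; exists (g j) => //; rewrite (blockE _ _ Kj).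
Qed.

Lemma eq_is_tree (T : finType) (e e' : rel T) : e =2 e' -> is_tree e = is_tree e'.
Proof.
move=> ee'; rewrite /is_tree /acyclic; congr [&& _, _, _ & _].
- by apply: eq_forallb => x; rewrite ee'.
- by apply: eq_forallb => x; apply: eq_forallb => y; rewrite !ee'.
- by apply: eq_forallb => x; apply: eq_forallb => y; rewrite (eq_connect ee').
apply: eq_forallb => k; apply: eq_forallb => s.
by rewrite /ucycleb (eq_cycle ee').
Qed.

(** ** Edge-colored trees *)

Section EdgeColored.
Variables (m n : nat).
Local Notation C := 'I_m.+1.
Local Notation T := 'I_n.+1.
Implicit Types (R : rtree C T) (t u : ecgraph m.+1 T).

(** The edge from a node to its parent carries the color of the node. *)
Definition ec_link R (x y : T) : option C :=
  if (x != top R) && (par R x == y) then Some (col R x)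
  else if (y != top R) && (par R y == x) then Some (col R y) else None.

Lemma isSome_ec_link R x y : isSome (ec_link R x y) = link R x y.
Proof. by rewrite /ec_link /link; case: ifP => //= _; case: ifP. Qed.

Lemma ec_link_par R x : x != top R -> ec_link R x (par R x) = Some (col R x).
Proof. by move=> xr; rewrite /ec_link xr eqxx. Qed.

Lemma ec_link_sym R : rooted R -> forall x y, ec_link R x y = ec_link R y x.
Proof.
move=> [d _ dP] x y; rewrite /ec_link.
case: ifP => // /andP[xr /eqP xy]; case: ifP => // /andP[yr /eqP yx].
by have := dP x xr; rewrite xy (dP y yr) yx => /eqP;
  rewrite -addn2 -{1}(addn0 (d x)) eqn_add2l.
Qed.

Definition ec_presents t R := ec_root t = top R /\ ec_color t =2 ec_link R.

Lemma ec_presented t : is_ectree t -> exists2 R, rooted R & ec_presents t R.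
Proof.
case/andP=> tree_t /forallP colC.
have {}colC x y : ec_color t x y = ec_color t y x.
  by apply/eqP; have /forallP := colC x; apply.
have [p pP] := tree_rooted (ec_root t) tree_t.
pose R := RTree (ec_root t) p (fun x => odflt ord0 (ec_color t x (p x))).
have [Rr adjE] := pP _ (col R); exists R => //; split=> // x y.
have := adjE x y; rewrite -isSome_ec_link /ec_adj /= -/R /ec_link.
case: ifP => [/andP[_ /eqP<-] /=|_]; first by case: (ec_color _ _ _).
case: ifP => [/andP[_ /eqP<-] /=|_]; last by case: (ec_color _ _ _).
by rewrite colC; case: (ec_color _ _ _).
Qed.

Definition ec_shape t (x : shape) : Prop :=
  exists R sh, [/\ rooted R, shaped R sh, ec_presents t R & sh (top R) = x].

Lemma ec_isoE t u x y : ec_shape t x -> ec_shape u y -> ec_iso t u = (x == y).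
Proof.
move=> [R [sh [Rr shP [rt ct] <-]]] [R' [sh' [Rr' shP' [ru cu] <-]]].
apply/existsP/eqP => [[s /andP[/eqP s0 /forallP sP]]
                     | /(same_shape_risom Rr Rr' shP shP')].
  have {sP}sE v w : ec_link R' (s v) (s w) = ec_link R v w.
    by rewrite -ct -cu; apply/eqP; have /forallP := sP v; apply.
  rewrite rt ru in s0.
  have s_par := link_par Rr Rr' (@perm_inj _ s) s0.
  have s_iso : risom R R' s.
    split=> // [|v vr]; first by exists (s^-1)%g; [apply: permK | apply: permKV].
    have pv : par R' (s v) = s (par R v).
      by apply: s_par => // v' w; rewrite -!isSome_ec_link sE.
    split=> //; apply: Some_inj; rewrite -(ec_link_par vr) -sE -pv ec_link_par //.
    by rewrite -s0 (inj_eq perm_inj).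
  by rewrite -s0 (risom_shape Rr s_iso shP shP').
move=> [f [f_bij f0 fP]]; have f_inj := bij_inj f_bij.
exists (perm f_inj); rewrite permE rt ru f0 eqxx.
apply/forallP=> v; apply/forallP=> w; rewrite ct cu !permE /ec_link.
rewrite -f0 !(inj_eq f_inj).
apply/eqP; have [->|/fP[-> ->]] /= := eqVneq v (top R);
  have [->|/fP[-> ->]] //= := eqVneq w (top R); by rewrite !(inj_eq f_inj).
Qed.

Lemma ec_shape_exists t :
  is_ectree t -> exists2 x, x \in level C n & ec_shape t x.
Proof.
move=> /ec_presented[R Rr tR]; have [sh shP] := shaped_exists Rr.
exists (sh (top R)); last by exists R, sh.
by have := shape_level Rr shP (top R); rewrite (shape_size_card shP) card_ord.
Qed.

Lemma ec_shape_realized x :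
  x \in level C n -> exists2 t, is_ectree t & ec_shape t x.
Proof.
move=> /(realize_ord ord0)[R [sh [Rr shP shx _]]].
pose t : ecgraph m.+1 T := (top R, [ffun x => [ffun y => ec_link R x y]]).
have tE : ec_color t =2 ec_link R by move=> v w; rewrite /ec_color !ffunE.
exists t; last by exists R, sh.
apply/andP; split; last first.
  by apply/forallP=> v; apply/forallP=> w; rewrite !tE ec_link_sym.
rewrite (eq_is_tree (e' := link R)) ?link_tree // => v w.
by rewrite /ec_adj /= tE isSome_ec_link.
Qed.

Lemma nprk_conditionsE : nprk_conditions m.+1 n.+1 = size (level C n).
Proof.
apply: (card_classes (K := ec_shape)) (level_uniq C n) _ _ _.
- by move=> t; rewrite inE => /ec_shape_exists.
- by move=> x /ec_shape_realized[t tP tx]; exists t; rewrite ?inE.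
- exact: ec_isoE.
Qed.

End EdgeColored.

(** ** Node-colored trees *)

Section NodeColored.
Variables (M n : nat).
Local Notation C := 'I_M.
Local Notation T := 'I_n.+1.
Implicit Types (R : rtree C T) (t u : ncgraph M T).

Definition nc_presents t R :=
  [/\ nc_root t = top R, nc_adj t =2 link R & nc_color t =1 col R].

Lemma nc_presented t : is_nctree t -> exists2 R, rooted R & nc_presents t R.
Proof.
move=> /(tree_rooted (nc_root t))[p /(_ _ (nc_color t))[Rr adjE]].
by exists (RTree (nc_root t) p (nc_color t)).
Qed.

(** The color of the root is recorded besides the shape. *)
Definition nc_shape t (y : item C) : Prop :=
  exists R sh, [/\ rooted R, shaped R sh, nc_presents t R &
    (sh (top R), col R (top R)) = y].

Lemma nc_isoE t u x y : nc_shape t x -> nc_shape u y -> nc_iso t u = (x == y).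
Proof.
move=> [R [sh [Rr shP [rt at_ ct] <-]]] [R' [sh' [Rr' shP' [ru au cu] <-]]].
apply/existsP/eqP => [[s /and3P[/eqP s0 /forallP sP /forallP sc]] | [sh0 col0]].
  have {sP}sE v w : link R' (s v) (s w) = link R v w.
    by rewrite -at_ -au; apply/eqP; have /forallP := sP v; apply.
  have {}sc v : col R' (s v) = col R v by rewrite -ct -cu; apply/eqP.
  rewrite rt ru in s0.
  have s_par := link_par Rr Rr' (@perm_inj _ s) s0 sE.
  have s_iso : risom R R' s.
    split=> // [|v vr]; first by exists (s^-1)%g; [apply: permK | apply: permKV].
    by split=> //; apply: s_par.
  by rewrite -s0 (risom_shape Rr s_iso shP shP') sc.
have [f f_iso] := same_shape_risom Rr Rr' shP shP' sh0.
have [f_bij f0 fP] := f_iso; have f_inj := bij_inj f_bij.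
exists (perm f_inj); rewrite permE rt ru f0 eqxx /=; apply/andP; split.
  by apply/forallP=> v; apply/forallP=> w; rewrite at_ au !permE (risom_link f_iso).
apply/forallP=> v; rewrite ct cu permE.
by have [->|/fP[_ ->]] := eqVneq v (top R); rewrite ?f0 ?col0.
Qed.

Lemma nc_shape_exists t :
  is_nctree t -> exists2 y, y \in colored C (level C n) & nc_shape t y.
Proof.
move=> /nc_presented[R Rr tR]; have [sh shP] := shaped_exists Rr.
exists (sh (top R), col R (top R)); last by exists R, sh.
rewrite mem_colored; have := shape_level Rr shP (top R).
by rewrite (shape_size_card shP) card_ord.
Qed.

Lemma nc_shape_realized y :
  y \in colored C (level C n) -> exists2 t, is_nctree t & nc_shape t y.
Proof.
case: y => x c; rewrite mem_colored => /(realize_ord c)[R [sh [Rr shP shx colc]]].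
pose t : ncgraph M T :=
  (top R, [ffun x => [ffun y => link R x y]], [ffun x => col R x]).
have tE : nc_adj t =2 link R by move=> v w; rewrite /nc_adj !ffunE.
exists t; last first.
  by exists R, sh; split; rewrite ?shx ?colc //; split=> // v;
    rewrite /nc_color ffunE.
by rewrite /is_nctree (eq_is_tree tE) link_tree.
Qed.

Lemma ark_conditionsE : ark_conditions M n.+1 = M * size (level C n).
Proof.
have <- : size (colored C (level C n)) = M * size (level C n).
  by rewrite size_allpairs -cardE card_ord mulnC.
apply: (card_classes (K := nc_shape)).
- by rewrite allpairs_uniq ?level_uniq ?enum_uniq // => -[? ?] [? ?] _ _.
- by move=> t; rewrite inE => /nc_shape_exists.
- by move=> y /nc_shape_realized[t tP ty]; exists t; rewrite ?inE.
- exact: nc_isoE.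
Qed.

End NodeColored.

(** * The number of order conditions *)

Lemma level_series_identity (M : nat) :
  ark_series_identity M (fun i => size (level 'I_M i.-1)).
Proof. by move=> n; exists n => m nm; rewrite /= (level_series _ nm) card_ord. Qed.

Local Open Scope ring_scope.

Theorem mainTheorem3 (M i : nat) (hM : (1 <= M)%N) (hi : (1 <= i)%N) :
  (nprk_conditions M i)%:R = (M%:R)^-1 * (ark_conditions M i)%:R :> rat
  /\ (forall alpha : nat -> nat, ark_series_identity M alpha ->
        nprk_conditions M i = alpha i).
Proof.
case: M hM => // m _; case: i hi => // n _; rewrite nprk_conditionsE; split.
  by rewrite ark_conditionsE natrM mulKf // Num.Theory.pnatr_eq0.
move=> alpha alphaP.
exact: (ark_series_unique (level_series_identity m.+1) alphaP (ltn0Sn n)).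
Qed.
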